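(* Let $G$ be a finite group and let $r=\mathrm{rk}(G')$. Then $|G:\mathbf{Z}_2(G)|\leq |G'|^{2r}$.
   Context: $G'$ is the derived (commutator) subgroup of $G$. $\mathbf{Z}_2(G)$ is the second member of the upper central series of $G$, i.e. $\mathbf{Z}_2(G)/\mathbf{Z}(G)=\mathbf{Z}(G/\mathbf{Z}(G))$, where $\mathbf{Z}(G)$ is the centre. The rank $\mathrm{rk}(H)$ of a finite group $H$ is the minimal number $r$ such that every subgroup of $H$ can be generated by $r$ elements. *)

(* Defs.v *)
From HB Require Import structures.
From mathcomp Require Import all_boot all_order all_fingroup all_solvable.

Set Implicit Arguments.
Unset Strict Implicit.
Unset Printing Implicit Defensive.

Local Open Scope group_scope.

(* A tuple may repeat entries, so this means "by at most r elements". *)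
Definition generated_by (gT : finGroupType) (r : nat) (K : {set gT}) : bool :=
  [exists t : r.-tuple gT, <<[set x in t]>> == K].

Definition subgroups_generated_by (gT : finGroupType) (A : {set gT}) (r : nat) :
    bool :=
  [forall K : {group gT}, (K \subset A) ==> generated_by r K].

Fact subgroups_generated_by_exists (gT : finGroupType) (A : {set gT}) :
  exists r, subgroups_generated_by A r.
Proof.
exists #|gT|; apply/forallP=> K; apply/implyP=> _; apply/existsP.
have sz : size [seq (if x \in K then x else 1) | x <- enum gT] == #|gT|.
  by rewrite size_map cardE.
exists (Tuple sz); rewrite -[X in _ == X]genGid eqEsubset; apply/andP; split.
  rewrite genS //; apply/subsetP=> y; rewrite inE => /mapP[x _ ->].
  by case: ifP => // _; apply: group1.
rewrite genS //; apply/subsetP=> y Ky; rewrite inE; apply/mapP.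
by exists y; rewrite ?mem_enum // Ky.
Qed.

(* This is not the library's 'r(A), which only involves the elementary        *)
(* abelian subgroups of A.                                                    *)
Definition subgroup_rank (gT : finGroupType) (A : {set gT}) : nat :=
  ex_minn (subgroups_generated_by_exists A).

(* Main.v *)
Require Import Defs.
From HB Require Import structures.
From mathcomp Require Import all_boot all_order all_fingroup all_solvable.

(** Let [D = G'] have rank [r] and let [C = 'C_G(D)]; the second centre lies
    in [C].  The index [|G : 'Z_2(G)|] is bounded in two steps, each of which
    contributes a factor [|D| ^ r], and each of which bounds the index of a
    centralizer by a product of [r] class sizes [index_cent_leq].

    First, [D] is generated by [r] elements, whose classes lie in [D], hence
    [|G : C| <= |D| ^ r].

    Next, put [A = D :&: C], an abelian group that contains [[~ x, g]] for all
    [x] in [C] and [g] in [G].  Since [x] centralizes [G'], its conjugate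
    [x ^ h] is centralized by every [g] that centralizes [x]
    [cent_der1_conj].  So if [x] in [C] is centralized by a subset [U] of [G],
    then all [[~ x, h]] lie in ['C_A(U)], and [x] is in ['Z_2(G)] as soon as
    this is central in [G].  It is thus enough to find a small [U] whose
    centralizer in [A] is ['C_A(G)].  There need not be one with [r] elements
    for [A] itself, as distinct primes may require distinct elements of [G],
    but there is one for a Sylow [p]-subgroup [P] of [A]
    [small_set_same_cent]: added elements of [U] can be made to shrink the
    socle of ['C_P(U) / 'C_P(G)], a vector space over the field with [p]
    elements that has dimension at most [r].  A [p]-element [x] of [C] has all
    its commutators [[~ x, g]] in [P], so the [p]-part of [|C : 'Z_2(G)|] is at
    most [|P| ^ r], a power of [p].  Over all primes [p], this makes
    [|C : 'Z_2(G)|] a divisor of [|A| ^ r]. *)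

Set Implicit Arguments.
Unset Strict Implicit.
Unset Printing Implicit Defensive.

Local Open Scope group_scope.

Lemma index_setI_leq (gT : finGroupType) (H A B : {group gT}) :
  A \subset H -> (#|H : A :&: B| <= #|H : A| * #|H : B|)%N.
Proof.
move=> sAH; rewrite -(Lagrange_index sAH (subsetIl A B)) leq_mul2l.
by apply/orP; right; rewrite indexgI subset_leq_card // imsetS.
Qed.

Lemma index_cent_leq (gT : finGroupType) (H : {group gT}) (U : {set gT}) m :
    (forall u, u \in U -> #|u ^: H| <= m)%N ->
  (#|H : 'C_H(U)| <= m ^ #|U|)%N.
Proof.
have [n] := ubnP #|U|; elim: n U => // n IHn U leUn le_m.
have [->|[u Uu]] := set_0Vmem U.
  by rewrite cards0 expn0 -cent_gen gen0 cent1T setIT indexgg.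
rewrite (cardsD1 u U) Uu in leUn *.
have -> : 'C_H(U) = 'C_H[u] :&: 'C_H(U :\ u).
  by rewrite -{1}(setD1K Uu) centU cent_set1 -setIACA setIid.
apply: leq_trans (index_setI_leq _ (subsetIl _ _)) _.
rewrite add1n expnS leq_mul ?index_cent1 ?le_m // IHn // => v.
by case/setD1P=> _; apply: le_m.
Qed.

Lemma card_class_leq (gT : finGroupType) (H P : {group gT}) g :
  {in H, forall x, [~ x, g] \in P} -> (#|g ^: H| <= #|P|)%N.
Proof.
move=> sRP; rewrite -(card_lcoset P g) subset_leq_card //.
apply/subsetP=> _ /imsetP[x Hx ->].
by rewrite mem_lcoset conjg_mulR mulKg -invgR groupV sRP.
Qed.

(** In an abelian [p]-group the rank is the dimension of the socle ['Ohm_1],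
    and a subgroup that misses an element of order [p] has a smaller socle. *)
Lemma rank_proper_Ohm1 (gT : finGroupType) p (B X : {group gT}) y :
    prime p -> p.-group B -> abelian B -> X \subset B ->
    y \in B -> #[y] = p -> y \notin X ->
  ('r(X) < 'r(B))%N.
Proof.
move=> p_pr pB abB sXB By oy nXy.
have pX := pgroupS sXB pB; have abX := abelianS sXB abB.
rewrite (rank_pgroup pX) (rank_pgroup pB) !p_rank_abelian //.
rewrite -(ltn_exp2l _ _ (prime_gt1 p_pr)).
rewrite -!card_pgroup ?(pgroupS (Ohm_sub 1 _)) //.
rewrite proper_card // properE OhmS //=; apply/subsetPn; exists y.
  by rewrite Ohm1Eprime mem_gen // inE By oy.
by apply: contra nXy; apply/subsetP/Ohm_sub.
Qed.

(** If ['C_P(U)] is larger than ['C_P(G)], choose an element of ['C_P(U)] whose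
    image in the quotient has order [p], and add to [U] an element of [G] that
    does not centralize it: the rank of the quotient decreases. *)
Lemma small_set_same_cent (gT : finGroupType) (p : nat) (P : {group gT})
    (G : {set gT}) :
    p.-group P -> abelian P ->
  exists U : {set gT},
    [/\ U \subset G, #|U| <= 'm(P) & 'C_P(U) \subset 'C(G)]%N.
Proof.
move=> pP abP; pose F := 'C_P(G)%G.
have sFP : F \subset P by apply: subsetIl.
have nF (X : {group gT}) : X \subset P -> X \subset 'N(F).
  by move=> sXP; rewrite cents_norm // (sub_abelian_cent2 abP).
suffices greedy k (X : {group gT}) : F \subset X -> X \subset P ->
      ('r(X / F) <= k)%N ->
    exists U : {set gT}, [/\ U \subset G, #|U| <= k & 'C_X(U) \subset F]%N.
  have [|U [sUG leU sCF]] := greedy 'm(P) P sFP (subxx _).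
    rewrite -grank_abelian ?quotient_abelian //.
    by rewrite quotient_grank ?nF.
  by exists U; split=> //; apply: subset_trans sCF (subsetIr _ _).
elim: k X => [|k IHk] X sFX sXP rX.
all: have [sXF|nsXF] := boolP (X \subset F);
  first by exists set0; rewrite sub0set cards0 subIset ?sXF.
all: have pX := pgroupS sXP pP;
  have abXF := quotient_abelian F (abelianS sXP abP).
all: have ntXF : X / F != 1 by rewrite -subG1 quotient_sub1 ?nF.
  by rewrite -rank_gt0 ltnNge rX in ntXF.
have [p_pr p_dv _] := pgroup_pdiv (quotient_pgroup F pX) ntXF.
have [_ /morphimP[x Nx Xx ->] oy] := Cauchy p_pr p_dv.
have nFx : x \notin F.
  apply: contraL (prime_gt1 p_pr) => Fx.
  by rewrite -oy /= coset_id // order1.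
have [g Gg cgx] : exists2 g, g \in G & x \notin 'C[g].
  have: x \notin 'C(G) by apply: contra nFx => cGx; rewrite inE (subsetP sXP).
  rewrite -sub1set centsC => /subsetPn[g Gg].
  by rewrite cent_set1 cent1C; exists g.
have sYX : 'C_X[g] \subset X by apply: subsetIl.
have sFY : F \subset 'C_X[g].
  by rewrite subsetI sFX -cent_set1 subIset // orbC centS // sub1set.
have nYx : coset F x \notin 'C_X[g] / F.
  apply: contra cgx => /morphimP[y Ny /setIP[_ cgy] /(rcoset_kercosetP Nx Ny)].
  case/rcosetP=> z /(subsetP sFY)/setIP[_ cgz] ->.
  by rewrite groupM.
have [|U [sUG leU sCF]] := IHk _ sFY (subset_trans sYX sXP).
  rewrite -ltnS (leq_trans _ rX) //.
  apply: (rank_proper_Ohm1 p_pr (quotient_pgroup F pX)) oy nYx => //.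
    exact: quotientS.
  by rewrite mem_quotient.
exists (g |: U); split.
- by rewrite subUset sub1set Gg.
- by rewrite cardsU1 (leq_add (leq_b1 _) leU).
by rewrite centU cent_set1 setIA.
Qed.

(** Both [h * g] and [g * h] conjugate [x] to the same element, because they
    differ by a commutator, which centralizes every conjugate of [x]. *)
Lemma cent_der1_conj (gT : finGroupType) (G : {group gT}) x g h :
    x \in 'C_G(G^`(1)) -> g \in G -> h \in G -> commute x g ->
  commute (x ^ h) g.
Proof.
move=> Cx Gg Gh cxg.
have nCG : G \subset 'N('C_G(G^`(1))).
  by rewrite normsI ?normG ?norms_cent ?der_norm.
have /setIP[_ cDxh] : x ^ h \in 'C_G(G^`(1)).
  by rewrite memJ_norm ?(subsetP nCG).
apply/commgP/conjg_fixP; rewrite -conjgM.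
have -> : h * g = g * h * [~ h, g] by rewrite -commgC.
rewrite conjgM [x ^ (g * h)]conjgM.
have -> : x ^ g = x by apply/conjg_fixP/commgP.
apply/conjg_fixP/commgP; apply: (centP cDxh).
by rewrite mem_commg.
Qed.

(** The three subgroups lemma, applied to [[~: 'Z_2(G), G, G] = 1]. *)
Lemma ucn2_sub_cent_der1 (gT : finGroupType) (G : {group gT}) :
  'Z_2(G) \subset 'C_G(G^`(1)).
Proof.
rewrite subsetI ucn_sub centsC /=.
have ZG1 : [~: 'Z_2(G), G, G] = 1.
  apply/commG1P; apply: subset_trans (subsetIr G _).
  rewrite -/'Z(G) -ucn1; exact: ucn_comm.
by apply/commG1P/three_subgroup; rewrite // [[~: G, _]]commGC.
Qed.

(** The [p]-part of [|C : 'Z_2(G)|] is at most [|S : 'C_S(U)|], where [S] is a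
    Sylow [p]-subgroup of [C] and [U] is chosen so that ['C_S(U)] lies in
    ['Z_2(G)]. *)
Lemma index_ucn2_partn (gT : finGroupType) (G A C P : {group gT}) (p : nat) r :
    C :=: 'C_G(G^`(1)) -> A :=: G^`(1) :&: C -> p.-Sylow(A) P ->
    ('m(P) <= r)%N ->
  (#|C : 'Z_2(G)|`_p <= #|P| ^ r)%N.
Proof.
move=> defC defA sylP rP.
have sCG : C \subset G by rewrite defC subsetIl.
have nCG : G \subset 'N(C).
  by rewrite defC normsI ?normG ?norms_cent ?der_norm.
have cDC : C \subset 'C(G^`(1)) by rewrite defC subsetIr.
have abA : abelian A.
  by rewrite /abelian defA (subset_trans (subsetIr _ _)) // (subset_trans cDC)
     ?centS ?subsetIl.
have RA x g : x \in C -> g \in G -> [~ x, g] \in A.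
  move=> Cx Gg; rewrite defA inE mem_commg ?(subsetP sCG x) //=.
  by rewrite commgEl groupM ?groupV ?memJ_norm ?(subsetP nCG).
have nsPA : P <| A by rewrite -sub_abelian_normal ?(pHall_sub sylP).
have RP x g : p.-elt x -> x \in C -> g \in G -> [~ x, g] \in P.
  move=> px Cx Gg; rewrite (mem_normal_Hall sylP) ?RA //.
  have cxR : commute x [~ x, g].
    have := RA x g Cx Gg; rewrite defA => /setIP[D_R _].
    exact: (centsP cDC).
  (* A product of commuting [p]-elements is a [p]-element. *)
  have cxJ : commute x^-1 (x ^ g).
    apply/commute_sym/commuteV; rewrite conjg_mulR.
    by apply/commute_sym/commuteM.
  by rewrite commgEl p_eltM ?p_eltV ?p_eltJ.
have [S sylS] := Sylow_exists p C.
have sSC := pHall_sub sylS; have pS := pHall_pgroup sylS.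
have RSP x g : x \in S -> g \in G -> [~ x, g] \in P.
  by move=> Sx Gg; rewrite RP ?(mem_p_elt pS) ?(subsetP sSC).
have sPA := pHall_sub sylP.
have [U [sUG leU sCU]] :=
  small_set_same_cent G (pHall_pgroup sylP) (abelianS sPA abA).
have sTZ : 'C_S(U) \subset 'Z_2(G).
  apply/subsetP=> x /setIP[Sx cUx]; have Cx := subsetP sSC x Sx.
  have Gx := subsetP sCG x Cx.
  rewrite ucnSnR inE Gx ucn1 gen_subG.
  apply/subsetP=> _ /imset2P[_ h /set1P-> Gh ->].
  have PR := RSP x h Sx Gh.
  rewrite inE; apply/andP; split; first by rewrite groupR.
  apply: (subsetP sCU); rewrite inE PR; apply/centP=> u Uu.
  have cxu := centP cUx u Uu.
  have Cx' : x \in 'C_G(G^`(1)) by rewrite -defC.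
  have cxhu := cent_der1_conj Cx' (subsetP sUG u Uu) Gh cxu.
  rewrite commgEl; apply/commute_sym/commuteM; last exact/commute_sym.
  exact/commuteV/commute_sym.
have sZC : 'Z_2(G) \subset C by rewrite defC ucn2_sub_cent_der1.
have idx : (#|S : 'C_S(U)| <= #|P| ^ r)%N.
  apply: leq_trans (index_cent_leq (m := #|P|) _) _ => [u Uu|].
    by apply: card_class_leq => x Sx; rewrite RSP ?(subsetP sUG).
  by rewrite leq_pexp2l // (leq_trans leU).
have leT : (#|'C_S(U)| <= #|'Z_2(G)|`_p)%N.
  rewrite dvdn_leq ?part_gt0 // -(part_pnat_id (pgroupS (subsetIl S _) pS)).
  by rewrite partn_dvd // cardSg.
(* Multiplied by [|'Z_2(G)|`_p], the left side becomes [|C|`_p = |S|]. *)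
rewrite -(leq_pmul2l (part_gt0 p #|'Z_2(G)|)) -partnM //.
rewrite Lagrange // -(card_Hall sylS) -(Lagrange (subsetIl S 'C(U))).
exact: leq_mul.
Qed.

Lemma index_cent_der1_ucn2_dvdn (gT : finGroupType) (G : {group gT}) r :
    (forall P : {group gT}, P \subset G^`(1) -> 'm(P) <= r)%N ->
  #|'C_G(G^`(1)) : 'Z_2(G)| %| #|G^`(1) :&: 'C_G(G^`(1))| ^ r.
Proof.
move=> rD; apply/dvdn_partP=> // p _.
have [P sylP] := Sylow_exists p (G^`(1) :&: 'C_G(G^`(1))).
have rP : ('m(P) <= r)%N.
  by rewrite rD // (subset_trans (pHall_sub sylP)) ?subsetIl.
have := @index_ucn2_partn _ _ _ _ _ p r erefl erefl sylP rP.
rewrite (card_Hall sylP) => le_p.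
apply: dvdn_trans (dvdn_part p _); rewrite partnX.
(* Between powers of one prime, the order is divisibility. *)
move: le_p; rewrite !p_part -expnM.
have [p_pr|np_pr] := boolP (prime p); last by rewrite lognE (negPf np_pr).
by rewrite leq_exp2l ?prime_gt1 // => /dvdn_exp2l->.
Qed.

Lemma generated_by_card (gT : finGroupType) r (K : {group gT}) :
  generated_by r K ->
  exists2 U : {set gT}, <<U>> = K & (#|U| <= r)%N.
Proof.
case/existsP=> t /eqP defK; exists [set x in t] => //.
by rewrite cardsE -[X in (_ <= X)%N](size_tuple t) card_size.
Qed.

Theorem theorem2 (gT : finGroupType) (G : {group gT}) (r : nat)
  (hr : r = subgroup_rank G^`(1)) :
  (#|G : 'Z_2(G)| <= #|G^`(1)| ^ (2 * r))%N.
Proof.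
have genD (K : {group gT}) : K \subset G^`(1) ->
    exists2 U : {set gT}, <<U>> = K & (#|U| <= r)%N.
  move=> sKD; apply: generated_by_card; move: hr; rewrite /subgroup_rank.
  by case: ex_minnP => m /forallP/(_ K)/implyP/(_ sKD) genK _ ->.
have [U defD leU] := genD _ (subxx G^`(1)).
have idxC : (#|G : 'C_G(G^`(1))| <= #|G^`(1)| ^ r)%N.
  rewrite -[in 'C_G(_)]defD cent_gen.
  apply: leq_trans (index_cent_leq (m := #|G^`(1)|) _) _ => [u Uu|].
    rewrite subset_leq_card // class_sub_norm ?der_norm //.
    by rewrite -defD mem_gen.
  by rewrite leq_pexp2l.
have idxZ : (#|'C_G(G^`(1)) : 'Z_2(G)| <= #|G^`(1)| ^ r)%N.
  have rD (P : {group gT}) : P \subset G^`(1) -> ('m(P) <= r)%N.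
    by case/genD=> V <- leV; apply: leq_trans (grank_min V) leV.
  apply: leq_trans (dvdn_leq _ (index_cent_der1_ucn2_dvdn rD)) _.
    by rewrite expn_gt0 cardG_gt0.
  by case: (r) => // k; rewrite leq_exp2r ?subset_leq_card ?subsetIl.
rewrite -(Lagrange_index (subsetIl G _) (ucn2_sub_cent_der1 G)).
by rewrite mul2n -addnn expnD mulnC leq_mul.
Qed.
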